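(* Let $(\tau_1,\tau_2)$ be the pair of termination times of the chains $(M_1,M_2)$ with parameters $(\bm{\alpha},\bm{P},\bm{U},\bm{Q}_1,\bm{Q}_2)$, and let $\tau_{1,2}$ be their common exit time from $\mathcal{E}$. For $\zeta_0,\zeta_1,\zeta_2\in[0,1]$, $$\mathbb{E}\left(\zeta_0^{\tau_{1,2}}\zeta_1^{\tau_1-\tau_{1,2}}\zeta_2^{\tau_2-\tau_{1,2}}\right)=\sum_{j\in\mathcal{S}}\big(\bm{\alpha}(\bm{I}\zeta_0^{-1}-\bm{P})^{-1}\bm{U}\big)_j\big((\bm{I}\zeta_1^{-1}-\bm{Q}_1)^{-1}\bm{q}_1\big)_j\big((\bm{I}\zeta_2^{-1}-\bm{Q}_2)^{-1}\bm{q}_2\big)_j,$$ and $$\mathbb{E}\left(\zeta_1^{\tau_1}\zeta_2^{\tau_2}\right)=\sum_{j\in\mathcal{S}}\big(\bm{\alpha}(\bm{I}(\zeta_1\zeta_2)^{-1}-\bm{P})^{-1}\bm{U}\big)_j\big((\bm{I}\zeta_1^{-1}-\bm{Q}_1)^{-1}\bm{q}_1\big)_j\big((\bm{I}\zeta_2^{-1}-\bm{Q}_2)^{-1}\bm{q}_2\big)_j.$$ Here, for $\zeta=0$, $(\bm{I}\zeta^{-1}-\bm{T})^{-1}$ is read as $\zeta(\bm{I}-\zeta\bm{T})^{-1}$, i.e. as $\bm{0}$.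
   Context: Construction. $\mathcal{E}$ and $\mathcal{S}$ are disjoint nonempty finite sets. $\bm{\alpha}$ is a probability row vector indexed by $\mathcal{E}$; $\bm{P}$ is a subprobability matrix (nonnegative entries, row sums at most $1$) on $\mathcal{E}$; $\bm{U}$ is a nonnegative $\mathcal{E}\times\mathcal{S}$ matrix such that each row of $(\bm{P}\ \bm{U})$ sums to one; $\bm{Q}_1,\bm{Q}_2$ are subprobability matrices on $\mathcal{S}$; $\bm{q}_k=\bm{1}-\bm{Q}_k\bm{1}$ for $k\in\{1,2\}$, where $\bm{1}$ is a column vector of ones. All chains terminate almost surely (from every state), i.e. all eigenvalues of $\bm{P},\bm{Q}_1,\bm{Q}_2$ have modulus strictly less than $1$. $\bm{I}$ denotes an identity matrix of appropriate dimension. $M_1$ is a terminating Markov chain (time $n=0,1,2,\dots$) on $\mathcal{E}\cup\mathcal{S}$ with initial vector $(\bm{\alpha},\bm{0})$ and subprobability transition matrix $\begin{pmatrix}\bm{P}&\bm{U}\\ \bm{0}&\bm{Q}_1\end{pmatrix}$ (the missing mass in a row is the probability of terminating at the next step). Let $\tau_{1,2}:=\inf\{n\ge 1: M_1(n)\notin\mathcal{E}\}$. Set $M_2(n)=M_1(n)$ for $n\le\tau_{1,2}$; after time $\tau_{1,2}$, given the past up to $\tau_{1,2}$, $M_2$ evolves independently of $M_1$ as a terminating Markov chain in $\mathcal{S}$ with subprobability matrix $\bm{Q}_2$. For $k\in\{1,2\}$, $\tau_k:=\inf\{n\ge 1: M_k(n)\notin\mathcal{E}\cup\mathcal{S}\}$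 (termination time). *)

(* Defs.v *)
From mathcomp Require Import all_boot all_order all_algebra.
From mathcomp Require Import all_classical all_reals all_analysis.
From mathcomp Require Import complex.

Set Implicit Arguments.
Unset Strict Implicit.
Unset Printing Implicit Defensive.

Import Order.TTheory GRing.Theory Num.Theory.
Local Open Scope classical_set_scope.
Local Open Scope ring_scope.

Section Matrices.
Context {R : realType}.

Definition prob_rv n (a : 'rV[R]_n) : Prop :=
  (forall i, 0 <= a 0 i) /\ \sum_i a 0 i = 1.

Definition nonneg_mx m n (A : 'M[R]_(m, n)) : Prop := forall i j, 0 <= A i j.

Definition subprob_mx n (A : 'M[R]_n) : Prop :=
  nonneg_mx A /\ forall i, \sum_j A i j <= 1.

(* Almost sure termination from every state of a chain with subprobability
   matrix [A]: all complex eigenvalues have modulus < 1. *)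
Definition terminating_mx n (A : 'M[R]_n) : Prop :=
  forall z : complex R, eigenvalue (map_mx (real_complex R) A) z -> `|z| < 1.

Definition exit_cv n (A : 'M[R]_n) : 'cV[R]_n :=
  const_mx 1 - A *m const_mx 1.

(* (I z^-1 - A)^-1; the case z = 0 is explicit because 0^-1 = 0 in MathComp. *)
Definition resolvent n (z : R) (A : 'M[R]_n) : 'M[R]_n :=
  if z == 0 then 0 else invmx (z^-1%:M - A).

End Matrices.

(* A terminating chain on ['I_n] is a process with values in [option 'I_n],
   where [None] is the absorbing state entered at termination. *)

Section Chains.
Context {R : realType}.

Definition init_prob n (a : 'rV[R]_n) (x : option 'I_n) : R :=
  if x is Some i then a 0 i else 1 - \sum_i a 0 i.

Definition trans_prob n (A : 'M[R]_n) (x y : option 'I_n) : R :=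
  match x, y with
  | Some i, Some j => A i j
  | Some i, None => 1 - \sum_j A i j
  | None, Some _ => 0
  | None, None => 1
  end.

Context d {Omega : measurableType d}.
Implicit Type T : Type.

Definition discrete_process T (X : nat -> Omega -> T) : Prop :=
  forall n x, measurable [set w | X n w = x].

Definition path_event T (X : nat -> Omega -> T) (k : nat) (x : nat -> T)
    (N : nat) : set Omega :=
  [set w | forall i, (i <= N)%N -> X (k + i)%N w = x i].

(* Conditionally on the event [B], the process [X k, X k.+1, ...] is a
   terminating Markov chain with matrix [A]. The states of that chain are read
   in the state space [T] of [X] through [emb]. Conditional probabilities are
   multiplied out, so nothing is required on null events. *)
Definition chain_given (Pr : probability Omega R) (B : set Omega)
    T n (emb : option 'I_n -> T) (X : nat -> Omega -> T) (k : nat)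
    (A : 'M[R]_n) : Prop :=
  forall (x : nat -> option 'I_n) (N : nat),
    (Pr (B `&` path_event X k (emb \o x) N.+1) =
     Pr (B `&` path_event X k (emb \o x) N)
       * (trans_prob A (x N) (x N.+1))%:E)%E.

Definition terminating_chain (Pr : probability Omega R) n
    (X : nat -> Omega -> option 'I_n) (a : 'rV[R]_n) (A : 'M[R]_n) : Prop :=
  (forall x, Pr [set w | X 0%N w = x] = (init_prob a x)%:E) /\
  chain_given Pr [set: Omega] id X 0 A.

(* Random times take values in [option nat], [None] standing for +oo. *)

(* inf {n >= 1 | X n \notin D} *)
Definition exit_time (T : finType) (X : nat -> Omega -> T) (D : {set T})
    (w : Omega) : option nat :=
  match pselect (exists n, (0 < n)%N && (X n w \notin D)) with
  | left h => Some (ex_minn h)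
  | right _ => None
  end.

Definition before (n : nat) (t : option nat) : Prop :=
  if t is Some k then (n <= k)%N else True.

(* [s - t], used only for [t <= s], so that [nat] subtraction does not truncate
   and finite [s] with infinite [t] does not occur. *)
Definition time_sub (s t : option nat) : option nat :=
  if s is Some m then (if t is Some k then Some (m - k)%N else Some 0%N)
  else None.

(* z ^ t for z in [0, 1], with z ^ +oo = lim_n z ^ n *)
Definition time_pow (z : R) (t : option nat) : R :=
  if t is Some k then z ^+ k else (z == 1)%:R.

End Chains.

(* The state space is ['I_(e + s)]: [lshift s i] for [i : 'I_e] are the
   elements of E, and [rshift e j] for [j : 'I_s] those of S;
   [None] is the absorbing state. *)

Section Pair.
Context {R : realType} {e s : nat}.

Definition state : finType := option 'I_(e + s).

Definition setE : {set state} := [set Some (lshift s i) | i : 'I_e]%SET.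
Definition setS : {set state} := [set Some (rshift e j) | j : 'I_s]%SET.

Definition inS (x : option 'I_s) : state := omap (@rshift e s) x.

Record parameters (alpha : 'rV[R]_e) (P : 'M[R]_e) (U : 'M[R]_(e, s))
    (Q1 Q2 : 'M[R]_s) : Prop := {
  E_nonempty : (0 < e)%N;
  S_nonempty : (0 < s)%N;
  alpha_prob : prob_rv alpha;
  P_subprob : subprob_mx P;
  U_nonneg : nonneg_mx U;
  PU_stochastic : forall i, \sum_j (row_mx P U) i j = 1;
  Q1_subprob : subprob_mx Q1;
  Q2_subprob : subprob_mx Q2;
  P_terminating : terminating_mx P;
  Q1_terminating : terminating_mx Q1;
  Q2_terminating : terminating_mx Q2 }.

Context d {Omega : measurableType d}.

Definition tau12 (M1 : nat -> Omega -> state) : Omega -> option nat :=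
  exit_time M1 setE.

Definition tau (M : nat -> Omega -> state) : Omega -> option nat :=
  exit_time M (setE :|: setS)%SET.

(* These events, over all [k] and [x], are the atoms of the past up to a finite
   [tau12]; [M2] agrees with [M1] until then. *)
Definition past (M1 : nat -> Omega -> state) (k : nat) (x : nat -> state) :
    set Omega :=
  [set w | tau12 M1 w = Some k] `&` path_event M1 0 x k.

Record chain_pair (Pr : probability Omega R) (alpha : 'rV[R]_e) (P : 'M[R]_e)
    (U : 'M[R]_(e, s)) (Q1 Q2 : 'M[R]_s) (M1 M2 : nat -> Omega -> state) :
    Prop := {
  M1_process : discrete_process M1;
  M2_process : discrete_process M2;
  M1_chain :
    terminating_chain Pr M1 (row_mx alpha 0) (block_mx P U 0 Q1);
  M2_eq_M1 : forall w n, before n (tau12 M1 w) -> M2 n w = M1 n w;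
  M2_chain : forall k x, chain_given Pr (past M1 k x) inS M2 k Q2;
  M1_M2_indep : forall k x y N1 z N2,
    let B := past M1 k x in
    let A1 := path_event M1 k y N1 in
    let A2 := path_event M2 k z N2 in
    (Pr (B `&` A1 `&` A2) * Pr B = Pr (B `&` A1) * Pr (B `&` A2))%E }.

End Pair.

Arguments state : clear implicits.

(* Main.v *)
Require Import Defs.
From mathcomp Require Import all_boot all_order all_algebra.
From mathcomp Require Import all_classical all_reals all_analysis.
From mathcomp Require Import measurable_realfun complex ring.

(** Say that the pair of chains follows the pattern [(j, k, a, b)] when [M1]
    spends its times [0, ..., k] in E, enters S at time [k + 1] in the state
    [j], makes [a] further moves inside S and then terminates, while [M2] makes
    [b] moves inside S after time [k + 1] and then terminates. On this event
    [tau12 = k + 1], [tau1 = tau12 + a + 1] and [tau2 = tau12 + b + 1]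
    ([lives_times]), so both integrands are constant there; in particular
    the second one is the first one at [zeta0 = zeta1 * zeta2], and one
    argument serves both formulas.

    The pattern has probability
    [(alpha P^k U)_j (Q1^a q1)_j (Q2^b q2)_j] ([lives_prob]). This is obtained
    by first-step induction: [sojourn_prob] prolongs a prescribed path by one
    state at a time, each prolongation costing one transition probability. It
    is used three times, for [M1] inside S, for [M2] inside S, and for [M1]
    inside E. The product form over the two chains comes from the fact that
    conditioning [M1] further on an event of [M2] that is conditionally
    independent of it keeps it a chain with matrix [Q1]
    ([chain_given_indep]).

    Multiplying by [z0^(k+1) z1^(a+1) z2^(b+1)] and summing over [k], [a] and
    [b] produces the three resolvents, because
    [\sum_k z^(k+1) A^k v = (z^-1 I - A)^-1 v] ([gensum_cvg]). For a
    terminating subprobability matrix the remainder of this series goes to [0]: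
    the vectors [A^k 1] decrease to a fixed vector of [A], which is zero since
    [1] is not an eigenvalue.

    Patterns with [k, a, b < N] are finitely many disjoint events. If [S_N z]
    is the corresponding part of the transform, then the expectation of an
    integrand with values in [0, 1] lies between [S_N z] and
    [S_N z + (1 - S_N 1)] ([expectation_sandwich]), the last bracket being the
    probability that none of these patterns occurs. The limit of [S_N 1] is the
    right-hand side at [z = 1], which equals [1] ([transform111]): the patterns
    exhaust all the probability, so every other behaviour (infinite times,
    forbidden transitions) is null at once. *)

Set Implicit Arguments.
Unset Strict Implicit.
Unset Printing Implicit Defensive.

Import Order.TTheory GRing.Theory Num.Theory.
Import numFieldNormedType.Exports.
Local Open Scope classical_set_scope.
Local Open Scope ring_scope.

(** * Resolvents of terminating subprobability matrices *)

Section Resolvent.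
Context {R : realType}.

Lemma cvg_fin_sum (I : finType) (F : I -> nat -> R) (l : I -> R) :
  (forall i, F i @ \oo --> l i) -> (fun n => \sum_i F i n) @ \oo --> \sum_i l i.
Proof. by move=> Fl; apply: cvg_big => // -[x y]; exact: add_continuous. Qed.

Definition ones n : 'cV[R]_n := const_mx 1.

(** [A^k v], in the form in which a first step of the chain is split off. *)
Definition mxiter n (A : 'M[R]_n) k (v : 'cV[R]_n) : 'cV[R]_n :=
  iter k (mulmx A) v.

Lemma mulmx_mono n (A : 'M[R]_n) (u v : 'cV[R]_n) : nonneg_mx A ->
  (forall i, u i 0 <= v i 0) -> forall i, (A *m u) i 0 <= (A *m v) i 0.
Proof. by move=> A0 uv i; rewrite !mxE ler_sum// => j _; rewrite ler_wpM2l. Qed.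

Lemma mxiter_mono n (A : 'M[R]_n) (u v : 'cV[R]_n) k : nonneg_mx A ->
  (forall i, u i 0 <= v i 0) -> forall i, mxiter A k u i 0 <= mxiter A k v i 0.
Proof. by move=> A0 uv; elim: k => [//|k IH] i /=; exact: mulmx_mono. Qed.

Lemma mxiterZ n (A : 'M[R]_n) (c : R) (v : 'cV[R]_n) k :
  mxiter A k (c *: v) = c *: mxiter A k v.
Proof. by elim: k => [//|k IH] /=; rewrite IH scalemxAr. Qed.

Lemma mxiterB n (A : 'M[R]_n) (u v : 'cV[R]_n) k :
  mxiter A k (u - v) = mxiter A k u - mxiter A k v.
Proof. by elim: k => [//|k IH] /=; rewrite IH mulmxBr. Qed.

Lemma mxiterS n (A : 'M[R]_n) (v : 'cV[R]_n) k :
  mxiter A k (A *m v) = mxiter A k.+1 v.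
Proof. by rewrite /mxiter -iterSr. Qed.

Lemma mxiter_ge0 n (A : 'M[R]_n) (v : 'cV[R]_n) k : nonneg_mx A ->
  (forall i, 0 <= v i 0) -> forall i, 0 <= mxiter A k v i 0.
Proof.
move=> A0 v0; elim: k => [//|k IH] i /=.
by rewrite mxE sumr_ge0// => j _; rewrite mulr_ge0.
Qed.

Lemma subprob_mx_ones n (A : 'M[R]_n) : subprob_mx A ->
  forall i, (A *m ones n) i 0 <= ones n i 0.
Proof.
move=> [A0 A1] i; rewrite !mxE; apply: le_trans (A1 i).
by rewrite ler_sum// => j _; rewrite mxE mulr1.
Qed.

Lemma singular_kernel n (B : 'M[R]_n) : B \notin unitmx ->
  exists2 v : 'cV[R]_n, v != 0 & B *m v = 0.
Proof.
rewrite -unitmx_tr -row_free_unit -kermx_eq0 => /rowV0Pn[v /sub_kermxP vB v0].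
exists v^T; first by rewrite -trmx0 (inj_eq trmx_inj).
by apply: trmx_inj; rewrite trmx_mul trmxK trmx0.
Qed.

(** A nonzero column fixed by [A] makes [1 - A] singular, hence gives a row
    fixed by [A], which over the complex numbers is an eigenvector for the
    eigenvalue [1], of modulus one. *)
Lemma terminating_no_fixpoint n (A : 'M[R]_n) (v : 'cV[R]_n) :
  terminating_mx A -> A *m v = v -> v = 0.
Proof.
move=> tA Av.
have [uA|nuA] := boolP ((1%:M - A) \in unitmx).
  by rewrite -[v]mul1mx -(mulVmx uA) -mulmxA mulmxBl mul1mx Av subrr mulmx0.
have /tA : eigenvalue (map_mx (real_complex R) A) 1.
  rewrite -(rmorph1 (real_complex R)) eigenvalue_map.
  move: nuA; rewrite -row_free_unit -kermx_eq0 => /rowV0Pn[u /sub_kermxP uA u0].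
  apply/eigenvalueP; exists u => //.
  by apply/esym/eqP; rewrite scale1r -subr_eq0 -[X in X - _]mulmx1 -mulmxBr uA.
by rewrite normr1 ltxx.
Qed.

(** The [i]-th entry is the probability of surviving [k] steps from [i]. It
    decreases since row sums are at most one, and the limit vector is fixed by
    [A], so that excluding the eigenvalue [1] suffices to conclude. *)
Lemma mxiter_ones_cvg0 n (A : 'M[R]_n) : subprob_mx A -> terminating_mx A ->
  forall i, (fun k => mxiter A k (ones n) i 0) @ \oo --> (0 : R).
Proof.
move=> sA tA.
have ni i : nonincreasing_seq (fun k => mxiter A k (ones n) i 0).
  apply/nonincreasing_seqP => k; rewrite -mxiterS.
  by apply: mxiter_mono; [case: sA|exact: subprob_mx_ones].
have cv i : cvgn (fun k => mxiter A k (ones n) i 0).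
  apply: nonincreasing_is_cvgn => //; exists 0 => _ [k _ <-].
  by apply: mxiter_ge0; [case: sA|move=> j; rewrite mxE].
pose v : 'cV[R]_n := \col_i limn (fun k => mxiter A k (ones n) i 0).
suff v0 : v = 0.
  move=> i; have <- : v i 0 = 0 by rewrite v0 mxE.
  by rewrite mxE; exact: cv.
apply: (terminating_no_fixpoint tA); apply/colP => i.
rewrite [RHS]mxE; apply/esym/cvg_lim => //.
rewrite -(cvg_shiftS (fun k => mxiter A k (ones n) i 0)).
under eq_fun do rewrite /= mxE; rewrite mxE.
by apply: cvg_fin_sum => j; apply: cvgMl_tmp; rewrite mxE; exact: cv.
Qed.

(** By nonnegativity of [A], [A^k v] is squeezed between the multiples
    [- c A^k 1] and [c A^k 1] with [c] a bound on the entries of [v]. *)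
Lemma mxiter_cvg0 n (A : 'M[R]_n) (v : 'cV[R]_n) :
  subprob_mx A -> terminating_mx A ->
  forall i, (fun k => mxiter A k v i 0) @ \oo --> (0 : R).
Proof.
move=> sA tA i; pose c := \sum_j `|v j 0|.
have vc j : - c <= v j 0 <= c.
  by rewrite -ler_norml /c (bigD1 j)//= lerDl sumr_ge0.
apply: (squeeze_cvgr (f := fun k => - c * mxiter A k (ones n) i 0)
  (h := fun k => c * mxiter A k (ones n) i 0)).
- near=> k; have A0 : nonneg_mx A by case: sA.
  have E (r : R) : r * mxiter A k (ones n) i 0 = mxiter A k (r *: ones n) i 0.
    by rewrite mxiterZ mxE.
  by rewrite !E !mxiter_mono// => j; rewrite !mxE mulr1; case/andP: (vc j).
- by rewrite -(mulr0 (- c)); apply: cvgMl_tmp; exact: mxiter_ones_cvg0.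
- by rewrite -(mulr0 c); apply: cvgMl_tmp; exact: mxiter_ones_cvg0.
Unshelve. all: by end_near.
Qed.

(** A vector [v] with [A v = z^-1 v] satisfies [A^k v = z^-k v], whose entries
    are at least those of [v] in modulus, while [A^k v] tends to [0]. *)
Lemma resolvent_unit n (A : 'M[R]_n) (z : R) : subprob_mx A -> terminating_mx A ->
  0 < z <= 1 -> z^-1%:M - A \in unitmx.
Proof.
move=> sA tA /andP[z0 z1]; apply/negPn/negP => /singular_kernel[v v0].
rewrite mulmxBl mul_scalar_mx => /eqP; rewrite subr_eq0 => /eqP Av.
have vk k : mxiter A k v = z^-1 ^+ k *: v.
  by elim: k => [|k IH] /=; rewrite ?scale1r// IH -scalemxAr -Av scalerA -exprSr.
have vA i k : `|v i 0| <= `|mxiter A k v i 0|.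
  rewrite vk mxE normrM ler_peMl// ger0_norm ?exprn_ge0 ?invr_ge0 ?(ltW z0)//.
  by apply: exprn_ege1; rewrite invf_ge1.
move/eqP: v0; apply; apply/colP => i; rewrite mxE; apply/eqP.
rewrite -normr_le0 -(normr0 R).
apply: (cvgr_to_ge (cvg_norm (mxiter_cvg0 v sA tA i))).
by near=> k; exact: vA.
Unshelve. all: by end_near.
Qed.

Definition gensum n (z : R) (A : 'M[R]_n) (v : 'cV[R]_n) i N : R :=
  \sum_(k < N) z ^+ k.+1 * mxiter A k v i 0.

(** With [w = (z^-1 I - A)^-1 v] one has [v = z^-1 w - A w], so the partial
    sums telescope to [w - z^N A^N w]. *)
Lemma gensum_cvg n (A : 'M[R]_n) (z : R) (v : 'cV[R]_n) i :
  subprob_mx A -> terminating_mx A -> 0 <= z <= 1 ->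
  gensum z A v i @ \oo --> (resolvent z A *m v) i 0.
Proof.
move=> sA tA /andP[z0 z1]; rewrite /resolvent.
have [->|zn0] := eqVneq z 0.
  rewrite mul0mx mxE; apply: cvg_near_cst; near=> N.
  by rewrite /gensum big1// => k _; rewrite expr0n mul0r.
have zgt0 : 0 < z by rewrite lt_def zn0.
have uA : z^-1%:M - A \in unitmx by apply: resolvent_unit; rewrite ?zgt0.
set w := invmx _ *m v.
have vE : v = z^-1 *: w - A *m w.
  by rewrite -mul_scalar_mx -mulmxBl /w mulmxA mulmxV// mul1mx.
have E N : gensum z A v i N = w i 0 - z ^+ N * mxiter A N w i 0.
  rewrite /gensum; elim: N => [|N IH].
    by rewrite big_ord0 expr0 mul1r subrr.
  have vN : mxiter A N v = z^-1 *: mxiter A N w - mxiter A N.+1 w.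
    by rewrite [in LHS]vE mxiterB mxiterZ mxiterS.
  rewrite big_ord_recr [LHS]/= IH vN.
  move: (mxiter A N w) (mxiter A N.+1 w) (w i 0) => a b c; rewrite !mxE.
  rewrite mulrBr mulrA [z ^+ N.+1 * z^-1]mulrC exprS mulKf//.
  by rewrite addrA subrK.
have zw : (fun N => z ^+ N * mxiter A N w i 0) @ \oo --> (0 : R); last first.
  rewrite (eq_cvg _ _ E); have := cvgB (cvg_cst (w i 0)) zw.
  by rewrite subr0; apply.
apply: norm_cvg0.
apply: (squeeze_cvgr (f := fun=> 0) (h := fun k => `|mxiter A k w i 0|)).
- near=> k; rewrite normr_ge0/= normrM ler_piMl// ger0_norm ?exprn_ge0//.
  by rewrite exprn_ile1.
- exact: cvg_cst.
- by rewrite -(normr0 R); apply: cvg_norm; exact: mxiter_cvg0.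
Unshelve. all: by end_near.
Qed.

End Resolvent.

(** * Expectations and finite families of disjoint events *)

Section Prob.
Context {R : realType} d {Omega : measurableType d} (Pr : probability Omega R).

Definition prob (A : set Omega) : R := fine (Pr A).

Lemma probE A : measurable A -> Pr A = (prob A)%:E.
Proof. by move=> mA; rewrite fineK// fin_num_measure. Qed.

Lemma prob_ge0 A : 0 <= prob A.
Proof. by rewrite fine_ge0. Qed.

Lemma prob_sum (I : finType) (F : I -> set Omega) :
  (forall i, measurable (F i)) -> (forall i j w, F i w -> F j w -> i = j) ->
  prob (\bigcup_i F i) = \sum_i prob (F i).
Proof.
move=> mF dF; rewrite /prob measure_fin_bigcup//; first last.
- by move=> i j _ _ [w [Fi Fj]]; exact: dF Fi Fj.
- exact: finite_finset.
rewrite (fsbigE (index_enum I)) ?index_enum_uniq//; last first.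
  by move=> i _; rewrite mem_index_enum.
rewrite big_mkcond/= (eq_bigr (fun i => (prob (F i))%:E)) ?sumEFin// => i _.
by rewrite in_setT probE.
Qed.

(** The integral of a nonnegative function is the supremum of the integrals of
    the simple functions below it, so monotonicity is inclusion of the two
    families of simple functions. In this form it applies directly to
    functions of the exit times. *)
Lemma ge0_le_integralT (f g : Omega -> \bar R) :
  (forall w, 0 <= f w <= g w)%E -> (\int[Pr]_w f w <= \int[Pr]_w g w)%E.
Proof.
move=> fg; have f0 w : (0 <= f w)%E by case/andP: (fg w).
have g0 w : (0 <= g w)%E by case/andP: (fg w); exact: le_trans.
rewrite !ge0_integralTE//.
apply: ge_ereal_sup => _ [h hf <-]; apply: ereal_sup_ubound; exists h => // w.
by apply: le_trans (hf w) _; case/andP: (fg w).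
Qed.

Lemma integral_step (I : finType) (F : I -> set Omega) (c : I -> R) :
  (forall i, measurable (F i)) -> (forall i, 0 <= c i) ->
  (\int[Pr]_w (\sum_i c i * \1_(F i) w)%:E = (\sum_i c i * prob (F i))%:E)%E.
Proof.
move=> mF c0.
under eq_integral do rewrite -sumEFin.
rewrite ge0_integral_sum//; last 2 first.
- by move=> i; apply/measurable_EFinP; exact: measurable_funM.
- by move=> i w _; rewrite lee_fin mulr_ge0.
rewrite -sumEFin; apply: eq_bigr => i _.
under eq_integral do rewrite EFinM.
rewrite ge0_integralZl//; last 2 first.
- by apply/measurable_EFinP.
- by rewrite lee_fin.
by rewrite integral_indic// setIT EFinM; congr (_ * _)%E; exact: probE.
Qed.

Lemma step_sum (I : finType) (F : I -> set Omega) (c : I -> R) i w :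
  (forall i j w, F i w -> F j w -> i = j) -> F i w ->
  \sum_j c j * \1_(F j) w = c i.
Proof.
move=> dF Fi; rewrite (bigD1 i)//= indicE mem_set// mulr1 big1 ?addr0// => j ji.
rewrite indicE memNset ?mulr0// => Fj.
by move: ji; rewrite (dF _ _ _ Fj Fi) eqxx.
Qed.

(** The step function [\sum_i c i 1_(F i)] is below [f], and adding to it the
    indicator of the complement of the [F i] gives a step function above [f],
    as [f <= 1]. *)
Lemma expectation_sandwich (I : finType) (F : I -> set Omega) (c : I -> R)
    (f : Omega -> R) :
  (forall i, measurable (F i)) -> (forall i j w, F i w -> F j w -> i = j) ->
  (forall w, 0 <= f w <= 1) -> (forall i w, F i w -> f w = c i) ->
  (forall i, 0 <= c i) ->
  ((\sum_i c i * prob (F i))%:E <= 'E_Pr[f] <=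
   (\sum_i c i * prob (F i) + (1 - \sum_i prob (F i)))%:E)%E.
Proof.
move=> mF dF f01 fc c0; rewrite expectation.unlock -integral_step//; apply/andP; split.
  apply: ge0_le_integralT => w; rewrite !lee_fin sumr_ge0/=; last first.
    by move=> i _; rewrite mulr_ge0.
  have [[i Fi]|nF] := pselect (exists i, F i w).
    by rewrite (step_sum _ dF Fi) (fc _ _ Fi).
  rewrite big1; first by case/andP: (f01 w).
  move=> i _; rewrite indicE memNset ?mulr0// => Fi; by apply: nF; exists i.
(* The upper step function is indexed by [option I], [None] standing for the
   complement, where the bound is [1]. *)
pose G := ~` \bigcup_i F i.
have mU : measurable (\bigcup_i F i) by apply: fin_bigcup_measurable.
have mG : measurable G by exact: measurableC.
have -> : 1 - \sum_i prob (F i) = prob G.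
  rewrite -prob_sum// /prob probability_setC// probE//=.
have -> : \sum_i c i * prob (F i) + prob G =
   \sum_(o : option I) odflt 1 (omap c o) * prob (oapp F G o).
  rewrite (bigD1 None)//= mul1r addrC; congr (_ + _).
  rewrite (reindex_omap Some id)//=; last by case.
  by apply: eq_bigl => i; rewrite eqxx.
rewrite -integral_step; last 2 first.
- by case.
- by case=> [i|] /=.
apply: ge0_le_integralT => w; rewrite !lee_fin; case/andP: (f01 w) => -> f1 /=.
have dG : forall i j w', oapp F G i w' -> oapp F G j w' -> i = j.
  move=> [i|] [j|] w' //= Fi Fj; first by rewrite (dF _ _ _ Fi Fj).
  - by case: Fj; exists i.
  - by case: Fi; exists j.
have [[i Fi]|nF] := pselect (exists i, F i w).
  by rewrite (@step_sum _ (oapp F G) _ (Some i) w dG Fi)/= (fc _ _ Fi).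
rewrite (@step_sum _ (oapp F G) _ None w dG)//=.
by move=> [i _ Fi]; apply: nF; exists i.
Qed.

End Prob.

(** * Prescribed paths and sojourns *)

Section Sojourn.
Context {R : realType} d {Omega : measurableType d} (Pr : probability Omega R).

(** The path [x] up to time [N], followed by the state [t]. It is total, hence
    constant from [N + 1] on, where path events of length [N + 1] stop. *)
Definition extend T (x : nat -> T) N (t : T) : nat -> T :=
  fun i => if (i <= N)%N then x i else t.

Lemma path_event_extend T (X : nat -> Omega -> T) k x N t :
  path_event X k (extend x N t) N.+1 =
  path_event X k x N `&` [set w | X (k + N.+1)%N w = t].
Proof.
apply/seteqP; split => w /=.
  move=> H; split => [i iN|].
    by have := H i (leqW iN); rewrite /extend iN.
  by have := H N.+1 (leqnn _); rewrite /extend ltnn.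
move=> [H Ht] i; rewrite leq_eqVlt => /predU1P[->|]; rewrite /extend.
  by rewrite ltnn.
by rewrite ltnS => iN; rewrite iN; exact: H.
Qed.

Lemma path_event_eq T (X : nat -> Omega -> T) k x y N :
  (forall i, (i <= N)%N -> x i = y i) -> path_event X k x N = path_event X k y N.
Proof.
by move=> xy; apply/seteqP; split => w H i iN; rewrite H// xy.
Qed.

Lemma measurable_path T (X : nat -> Omega -> T) k x N :
  discrete_process X -> measurable (path_event X k x N).
Proof.
move=> mX; elim: N => [|N IH].
  rewrite (_ : path_event _ _ _ _ = [set w | X (k + 0)%N w = x 0%N]) //.
  apply/seteqP; split => w /=; first exact.
  by move=> H i; rewrite leqn0 => /eqP ->.
rewrite (path_event_eq _ _ (y := extend x N (x N.+1))).
  by rewrite path_event_extend; exact: measurableI.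
move=> i; rewrite leq_eqVlt /extend => /predU1P[->|]; first by rewrite ltnn.
by rewrite ltnS => ->.
Qed.

(** Defined by recursion on the first step, the form needed for first-step
    analysis; [sojournP] gives the description by absolute times. *)
Fixpoint sojourn T (I : Type) (X : nat -> Omega -> T) (f : I -> T) (t : T) m k :
    set Omega :=
  if k is k'.+1 then (\bigcup_j [set w | X m.+1 w = f j]) `&` sojourn X f t m.+1 k'
  else [set w | X m.+1 w = t].

Lemma measurable_sojourn T (I : finType) (X : nat -> Omega -> T) (f : I -> T) t m k :
  discrete_process X -> measurable (sojourn X f t m k).
Proof.
move=> mX; elim: k m => [|k IH] m /=; first exact: mX.
by apply: measurableI => //; apply: fin_bigcup_measurable => // j _; exact: mX.
Qed.

Lemma sojournP T (I : Type) (X : nat -> Omega -> T) (f : I -> T) t m k w :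
  sojourn X f t m k w ->
  (forall i, (m < i <= m + k)%N -> exists j, X i w = f j) /\
  X (m + k).+1 w = t.
Proof.
elim: k m => [|k IH] m /=.
  by rewrite addn0 => ->; split => // i; case: ltnP => //= ?; rewrite leqNgt => /negP.
move=> [[j _ Xj] /IH[H Ht]]; split; last by rewrite addnS -addSn.
move=> i /andP[mi ik]; move: mi; rewrite leq_eqVlt => /predU1P[<-|mi].
  by exists j.
by apply: H; rewrite mi addSn -addnS.
Qed.

(** First-step analysis. One step inside the range of [f] splits the event
    according to the state [f j] visited, and each part is again an event of the
    same kind, for a path longer by one. The induction ends at length [K], when
    the last jump, to [t], is left; [v i] is the conditional probability of this
    jump and of the event [D], given the path and its last state [f i]. *)
Lemma sojourn_prob T n (X : nat -> Omega -> T) (f : 'I_n -> T) (t : T)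
    (A : 'M[R]_n) (v : 'cV[R]_n) (C D : set Omega) (k0 K : nat) :
  injective f -> discrete_process X -> measurable C -> measurable D ->
  (forall u N j,
    prob Pr (C `&` path_event X k0 (extend (f \o u) N (f j)) N.+1) =
    prob Pr (C `&` path_event X k0 (f \o u) N) * A (u N) j) ->
  (forall u,
    prob Pr (C `&` path_event X k0 (extend (f \o u) K t) K.+1 `&` D) =
    prob Pr (C `&` path_event X k0 (f \o u) K) * v (u K) 0) ->
  forall k N u, (N + k)%N = K ->
    prob Pr (C `&` path_event X k0 (f \o u) N `&` sojourn X f t (k0 + N) k `&` D) =
    prob Pr (C `&` path_event X k0 (f \o u) N) * mxiter A k v (u N) 0.
Proof.
move=> injf mX mC mD stepA endv; elim=> [|k IH] N u.
  by rewrite addn0 => NK; subst K; rewrite -endv path_event_extend setIA addnS.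
move=> NK; rewrite [in RHS]/= mxE mulr_sumr.
have E j : extend (f \o u) N (f j) = f \o extend u N j.
  by apply/funext => i; rewrite /extend/=; case: ifP.
transitivity (\sum_j prob Pr (C `&` path_event X k0 (f \o extend u N j) N.+1 `&`
                 sojourn X f t (k0 + N.+1) k `&` D)).
  rewrite -prob_sum; last 2 first.
  - move=> j; apply: measurableI => //; apply: measurableI.
      by apply: measurableI => //; exact: measurable_path.
    exact: measurable_sojourn.
  - move=> i j w; rewrite -!E !path_event_extend.
    move=> [[[_ [_ /= Xi]] _] _] [[[_ [_ /= Xj]] _] _].
    by apply: injf; rewrite -Xi -Xj.
  congr (prob Pr _); rewrite addnS; apply/seteqP; split => w.
    move=> [[[Cw Pw] [[j _ Xj] Sw]] Dw]; exists j => //.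
    by rewrite -E path_event_extend addnS.
  move=> [j _]; rewrite -E path_event_extend addnS => -[[[Cw [Pw Xj]] Sw] Dw].
  by split => //; split => //; split => //; exists j.
apply: eq_bigr => j _; rewrite IH; last by rewrite addSn -addnS.
by rewrite -E stepA {1}/extend ltnn mulrA.
Qed.

Lemma exit_timeP (T : finType) (X : nat -> Omega -> T) (D : {set T}) w n :
  (0 < n)%N -> X n w \notin D -> (forall i, (0 < i < n)%N -> X i w \in D) ->
  exit_time X D w = Some n.
Proof.
move=> n0 Xn Xi; rewrite /exit_time; case: pselect => [h|[]]; last first.
  by exists n; rewrite n0.
congr Some; case: ex_minnP => m /andP[m0 Xm] minm; apply/eqP.
rewrite eqn_leq minm ?n0//= leqNgt; apply: contra Xm => mn.
by rewrite Xi// m0.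
Qed.

End Sojourn.

(** * Chains conditioned on an event *)

Section ChainGiven.
Context {R : realType} d {Omega : measurableType d} (Pr : probability Omega R).

(** The form of the chain property required by [sojourn_prob]: a path of
    living states, and one more state, living or not. *)
Lemma chain_given_extend n T (emb : option 'I_n -> T) (X : nat -> Omega -> T) k
    (A : 'M[R]_n) (C : set Omega) (u : nat -> 'I_n) N y :
  measurable C -> discrete_process X -> chain_given Pr C emb X k A ->
  prob Pr (C `&` path_event X k (extend ((emb \o Some) \o u) N (emb y)) N.+1) =
  prob Pr (C `&` path_event X k ((emb \o Some) \o u) N) *
    trans_prob A (Some (u N)) y.
Proof.
move=> mC mX /(_ (extend (Some \o u) N y) N).
rewrite {3 4}/extend leqnn ltnn.
rewrite (path_event_eq _ _ (y := extend ((emb \o Some) \o u) N (emb y))); last first.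
  by move=> i _; rewrite /extend /=; case: ifP.
rewrite (@path_event_eq _ _ _ _ _ _ ((emb \o Some) \o u) N); last first.
  by move=> i iN; rewrite /extend /= iN.
by move=> H; apply: EFin_inj; rewrite EFinM -!probE//;
  apply: measurableI => //; exact: measurable_path.
Qed.

(** The Markov property at time [k]: if the two paths disagree at time [k] both
    sides vanish, and otherwise they concatenate to one path from time [0]. *)
Lemma chain_given_restart n (X : nat -> Omega -> option 'I_n) (A : 'M[R]_n) k x :
  chain_given Pr [set: Omega] id X 0 A ->
  chain_given Pr (path_event X 0 x k) id X k A.
Proof.
move=> H y N; have [xy|xy] := eqVneq (x k) (y 0%N); last first.
  have E M : path_event X 0 x k `&` path_event X k (id \o y) M = set0.
    rewrite -subset0 => w [/(_ k (leqnn _)) /= Xk /(_ 0%N (leq0n _))].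
    by rewrite /= addn0 Xk => /eqP; rewrite (negbTE xy).
  by rewrite !E measure0 mul0e.
(* The concatenation of the two paths, glued at time [k]. *)
pose z i := if (i <= k)%N then x i else y (i - k)%N.
have zE i : z (k + i)%N = y i.
  rewrite /z; case: i => [|i]; first by rewrite addn0 leqnn xy.
  by rewrite addnS ltnNge leq_addr /= -addnS addKn.
have E M : path_event X 0 x k `&` path_event X k (id \o y) M =
    [set: Omega] `&` path_event X 0 (id \o z) (k + M).
  rewrite setTI; apply/seteqP; split => w.
    move=> [P0 P1] i iM; rewrite /=; have [ik|ki] := leqP i k.
      by rewrite P0// /z ik.
    have -> : i = (k + (i - k))%N by rewrite subnKC// ltnW.
    by rewrite zE; apply: P1; rewrite leq_subLR.
  move=> P; split => i iM.
    by rewrite P ?(leq_trans iM) ?leq_addr//= /z iM.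
  by rewrite -[(k + i)%N]add0n P ?leq_add2l//= zE.
by rewrite !E addnS H -!addnS !zE.
Qed.

(** If [G] is independent of the path of [X] given [B], then
    [Pr (B, G, path) = Pr (G | B) Pr (B, path)], and the one-step equation is
    linear in the last factor. If [B] is null both sides vanish. *)
Lemma chain_given_indep n T (emb : option 'I_n -> T) (X : nat -> Omega -> T) k
    (A : 'M[R]_n) (B G : set Omega) :
  measurable B -> measurable G -> discrete_process X ->
  (forall y N, Pr (B `&` path_event X k y N `&` G) * Pr B =
               Pr (B `&` path_event X k y N) * Pr (B `&` G))%E ->
  chain_given Pr B emb X k A -> chain_given Pr (B `&` G) emb X k A.
Proof.
move=> mB mG mX ind ch x N.
have mP y M : measurable (path_event X k y M) by exact: measurable_path.
have mBP y M : measurable (B `&` path_event X k y M) by exact: measurableI.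
have mBG : measurable (B `&` G) by exact: measurableI.
have mBGP y M : measurable (B `&` G `&` path_event X k y M) by exact: measurableI.
have {}ind y M : prob Pr (B `&` G `&` path_event X k y M) * prob Pr B =
    prob Pr (B `&` path_event X k y M) * prob Pr (B `&` G).
  by apply: EFin_inj; rewrite !EFinM -!probE// setIAC; exact: ind.
have {}ch y M : prob Pr (B `&` path_event X k (emb \o y) M.+1) =
    prob Pr (B `&` path_event X k (emb \o y) M) * trans_prob A (y M) (y M.+1).
  by apply: EFin_inj; rewrite EFinM -!probE//; exact: ch.
rewrite !probE// -EFinM; congr EFin.
have [B0|B0] := eqVneq (prob Pr B) 0.
  have E F : measurable F -> F `<=` B -> prob Pr F = 0.
    move=> mF FB; apply/eqP; rewrite eq_le prob_ge0 andbT -B0 -lee_fin -!probE//.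
    by apply: le_measure => //; rewrite inE.
  by rewrite !E ?mul0r// => w [[]].
apply: (mulIf B0); rewrite ind ch mulrAC -[in RHS]mulrAC ind.
by rewrite mulrAC.
Qed.

End ChainGiven.

(** * The probability of a pattern of the two chains *)

Section Pair.
Context {R : realType} {e s : nat}.
Context (alpha : 'rV[R]_e) (P : 'M[R]_e) (U : 'M[R]_(e, s)) (Q1 Q2 : 'M[R]_s).
Context d {Omega : measurableType d} (Pr : probability Omega R).
Context (M1 M2 : nat -> Omega -> state e s).
Context (HM : chain_pair Pr alpha P U Q1 Q2 M1 M2).

Let mM1 : discrete_process M1 := M1_process HM.
Let mM2 : discrete_process M2 := M2_process HM.

(** The counterpart of [inS] for E. *)
Definition toE (i : 'I_e) : state e s := Some (lshift s i).

Definition dies (X : nat -> Omega -> state e s) m a : set Omega :=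
  sojourn X (@inS e s \o Some) None m a.

Definition exits (j : 'I_s) k : set Omega :=
  (\bigcup_i [set w | M1 0%N w = toE i]) `&` sojourn M1 toE (inS (Some j)) 0 k.

(** The index [(j, k, a, b)] stands for the times
    [tau12 = k + 1], [tau1 - tau12 = a + 1], [tau2 - tau12 = b + 1] and the state
    [j] at time [tau12]. *)
Definition lives (c : 'I_s * nat * nat * nat) : set Omega :=
  let: (j, k, a, b) := c in exits j k `&` (dies M1 k.+1 a `&` dies M2 k.+1 b).

Lemma toE_inj : injective toE.
Proof. by move=> i j /Some_inj/lshift_inj. Qed.

Lemma inS_inj : injective (@inS e s \o Some).
Proof. by move=> i j /Some_inj/rshift_inj. Qed.

Lemma toE_setE i : toE i \in setE.
Proof. by apply/imsetP; exists i. Qed.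

Lemma inS_setE y : inS y \notin @setE e s.
Proof.
apply/imsetP => -[i _]; case: y => //= j /Some_inj/eqP.
by rewrite eq_rlshift.
Qed.

Lemma toE_alive i : toE i \in (setE :|: setS)%SET.
Proof. by rewrite inE toE_setE. Qed.

Lemma inS_alive j : inS (Some j) \in (@setE e s :|: setS)%SET.
Proof. by rewrite inE; apply/orP; right; apply/imsetP; exists j. Qed.

Lemma None_dead : None \notin (@setE e s :|: setS)%SET.
Proof. by rewrite inE; apply/norP; split; apply/imsetP => -[]. Qed.

(** The process [M2] has to be followed from time [0] to read [tau M2]; up to
    [tau12] it is [M1]. *)
Lemma lives_times j k a b w : lives (j, k, a, b) w ->
  [/\ tau12 M1 w = Some k.+1, M1 k.+1 w = inS (Some j),
      tau M1 w = Some (k.+1 + a.+1)%N & tau M2 w = Some (k.+1 + b.+1)%N].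
Proof.
move=> [[[i0 _ M10] SE] [S1 S2]].
have [ME MS] := sojournP SE; have [D1 N1] := sojournP S1; have [D2 N2] := sojournP S2.
rewrite add0n in ME MS.
have t12 : tau12 M1 w = Some k.+1.
  apply: exit_timeP => //; first by rewrite MS inS_setE.
  by move=> i /ME[l ->]; exact: toE_setE.
have tauX X c : (forall i, (i <= k.+1)%N -> X i w = M1 i w) ->
    (forall i, (k.+1 < i <= k.+1 + c)%N -> exists l, X i w = (inS \o Some) l) ->
    X (k.+1 + c).+1 w = None -> tau X w = Some (k.+1 + c.+1)%N.
  move=> XM XS XN; apply: exit_timeP; rewrite ?addnS ?XN//; first exact: None_dead.
  move=> i /andP[i0' iN]; have [ik|ki] := leqP i k.+1.
    move: (ik); rewrite leq_eqVlt => /predU1P[->|ik'].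
      by rewrite XM// MS inS_alive.
    have [l El] : exists l, M1 i w = toE l by apply: ME; rewrite i0'.
    by rewrite XM// El toE_alive.
  have [l ->] : exists l, X i w = (inS \o Some) l by apply: XS; rewrite ki -ltnS.
  exact: inS_alive.
split => //; apply: tauX => // i ik.
by apply: (M2_eq_M1 HM); rewrite t12.
Qed.

Lemma measurable_dies X m a : discrete_process X -> measurable (dies X m a).
Proof. exact: measurable_sojourn. Qed.

Lemma measurable_lives c : measurable (lives c).
Proof.
case: c => [[[j k] a] b]; apply: measurableI.
  apply: measurableI; last exact: measurable_sojourn.
  by apply: fin_bigcup_measurable => // i _; exact: mM1.
by apply: measurableI; exact: measurable_dies.
Qed.

Lemma lives_disjoint c c' w : lives c w -> lives c' w -> c = c'.
Proof.
case: c => [[[j k] a] b]; case: c' => [[[j' k'] a'] b'].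
move=> /lives_times[t Mj t1 t2] /lives_times[].
rewrite t => -[<-]; rewrite Mj => /inS_inj <-; rewrite t1 t2.
by move=> [/addnI[<-]] [/addnI[<-]].
Qed.

(** Given any path, [D] costs the same factor [c]; it is carried through the
    induction inside the end vector [c *: exit_cv Q]. *)
Lemma dies_prob (X : nat -> Omega -> state e s) k (Q : 'M[R]_s) (C D : set Omega)
    (c : R) (j : 'I_s) b :
  discrete_process X -> measurable C -> measurable D ->
  (forall w, C w -> X k w = inS (Some j)) ->
  chain_given Pr C (@inS e s) X k Q ->
  (forall y N, prob Pr (C `&` path_event X k y N `&` D) =
               prob Pr (C `&` path_event X k y N) * c) ->
  prob Pr (C `&` dies X k b `&` D) =
  prob Pr C * (c * mxiter Q b (exit_cv Q) j 0).
Proof.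
move=> mX mC mD CX ch indD.
(* A path of length zero from the state of [X] at time [k] adds nothing to [C]. *)
have CE : C `&` path_event X k ((inS \o Some) \o (fun=> j)) 0 = C.
  apply/seteqP; split => [w []//|w Cw]; split => // i.
  by rewrite leqn0 => /eqP ->; rewrite addn0 CX.
have := @sojourn_prob _ _ _ Pr _ _ X (inS \o Some) None Q (c *: exit_cv Q) C D k b
  inS_inj mX mC mD.
move=> /(_ _ _ b 0%N (fun=> j) (add0n b)); rewrite CE addn0 mxiterZ [in RHS]mxE.
apply.
- move=> u N l; exact: (chain_given_extend u N (Some l) mC mX ch).
- move=> u; rewrite indD (chain_given_extend u b None mC mX ch) mulrAC -mulrA.
  rewrite [X in _ = _ * X]mxE; congr (_ * (_ * _)); rewrite /exit_cv !mxE.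
  by congr (_ - _); apply: eq_bigr => l _; rewrite mxE mulr1.
Qed.

(** From a state of S the block matrix only allows transitions according to
    [Q1], including the termination probabilities. *)
Lemma M1_chain_inS k x : chain_given Pr (path_event M1 0 x k) (@inS e s) M1 k Q1.
Proof.
move=> y N; case: (M1_chain HM) => _ ch.
rewrite (chain_given_restart k x ch (inS \o y) N) /=; congr (_ * _%:E)%E.
case: (y N) (y N.+1) => [i|] [l|] //=.
  by rewrite block_mxEdr.
congr (1 - _); rewrite big_split_ord /= big1 ?add0r.
  by apply: eq_bigr => l _; rewrite block_mxEdr.
by move=> l _; rewrite block_mxEdl mxE.
Qed.

(** A path that stays in E up to [N] and jumps to S determines [tau12]. *)
Lemma past_path N (u : nat -> 'I_e) (j : 'I_s) :
  let x := extend (toE \o u) N (inS (Some j)) in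
  past M1 N.+1 x = path_event M1 0 x N.+1.
Proof.
move=> x; apply/seteqP; split => [w []//|w Pw]; split => //=.
apply: exit_timeP => //.
  by have := Pw N.+1 (leqnn _); rewrite add0n /x /extend ltnn => ->; exact: inS_setE.
move=> i /andP[_ iN]; have := Pw i (ltnW iN).
by rewrite add0n /x /extend ifT// => ->; exact: toE_setE.
Qed.

(** Given the past at [tau12] the two chains terminate independently. The sojourn
    of [M2] is expanded into paths with the termination of [M1] as the final event
    [D]; given each such path of [M2], the first chain still moves by [Q1]. *)
Lemma past_dies_prob N (u : nat -> 'I_e) (j : 'I_s) a b :
  let B := path_event M1 0 (extend (toE \o u) N (inS (Some j))) N.+1 in
  prob Pr (B `&` (dies M1 N.+1 a `&` dies M2 N.+1 b)) =
  prob Pr B * (mxiter Q1 a (exit_cv Q1) j 0 * mxiter Q2 b (exit_cv Q2) j 0).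
Proof.
move=> B; set x := extend _ _ _ in B *.
have pastE : past M1 N.+1 x = B := past_path N u j.
have mB : measurable B by exact: measurable_path.
have BM1 w : B w -> M1 N.+1 w = inS (Some j).
  by move=> /(_ N.+1 (leqnn _)); rewrite add0n /x /extend ltnn.
have BM2 w : B w -> M2 N.+1 w = inS (Some j).
  move=> Bw; rewrite -(BM1 w Bw); apply: (M2_eq_M1 HM).
  by move: Bw; rewrite -pastE => -[/= -> _] /=.
rewrite [dies M1 _ _ `&` _]setIC setIA.
apply: dies_prob => //.
- exact: measurable_dies.
- by rewrite -pastE; exact: (M2_chain HM).
- move=> z N2; set G := path_event M2 _ _ _.
  have mG : measurable G by exact: measurable_path.
  (* The same lemma, now for [M1], with the sure event as final event. *)
  rewrite -(mul1r (mxiter Q1 _ _ _ _)) -[LHS](congr1 (prob Pr) (setIT _)).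
  apply: dies_prob => //; first exact: measurableI.
  + by move=> w [/BM1].
  + apply: chain_given_indep => //; last exact: M1_chain_inS.
    move=> y M; have := M1_M2_indep HM N.+1 x y M z N2.
    by rewrite /= pastE.
  + by move=> y M; rewrite setIT mulr1.
Qed.

(** The sojourn of [M1] in E is expanded in turn, with the termination of
    both chains as the final event; the vector at its end is the column [j] of [U]
    times the two termination probabilities. *)
Lemma lives_prob j k a b :
  prob Pr (lives (j, k, a, b)) =
  (\sum_i alpha 0 i * mxiter P k (col j U) i 0) *
  mxiter Q1 a (exit_cv Q1) j 0 * mxiter Q2 b (exit_cv Q2) j 0.
Proof.
set c1 := mxiter Q1 _ _ _ _; set c2 := mxiter Q2 _ _ _ _.
case: (M1_chain HM) => ini ch.
set D := dies M1 k.+1 a `&` dies M2 k.+1 b.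
have mD : measurable D by apply: measurableI; exact: measurable_dies.
have start i : [set: Omega] `&` path_event M1 0 (toE \o (fun=> i)) 0 =
    [set w | M1 0%N w = toE i].
  rewrite setTI; apply/seteqP; split => w /= H; first exact: H.
  by move=> l; rewrite leqn0 => /eqP ->.
transitivity (\sum_i prob Pr ([set: Omega] `&` path_event M1 0 (toE \o (fun=> i)) 0
    `&` sojourn M1 toE (inS (Some j)) (0 + 0) k `&` D)).
  rewrite -prob_sum; last 2 first.
  - move=> i; rewrite start; apply: measurableI => //; apply: measurableI.
      exact: mM1.
    exact: measurable_sojourn.
  - move=> i i' w; rewrite !start => -[[/= Mi _] _] [[/= Mi' _] _].
    by apply: toE_inj; rewrite -Mi -Mi'.
  congr (prob Pr _); rewrite /lives /exits addn0 -/D.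
  by rewrite !setI_bigcupl; apply: eq_bigcupr => i _; rewrite start.
rewrite -mulrA mulr_suml; apply: eq_bigr => i _.
rewrite (@sojourn_prob _ _ _ Pr _ _ M1 toE (inS (Some j)) P ((c1 * c2) *: col j U)
  setT D 0 k toE_inj mM1 measurableT mD _ _ k 0%N (fun=> i) (add0n k)).
- have -> : prob Pr (setT `&` path_event M1 0 (toE \o (fun=> i)) 0) = alpha 0 i.
    rewrite start; apply: EFin_inj; rewrite -probE; last exact: mM1.
    by rewrite ini /= row_mxEl.
  by rewrite mxiterZ [X in _ * X]mxE; ring.
- move=> u N l.
  rewrite (chain_given_extend (lshift s \o u) N (Some (lshift s l)) measurableT mM1 ch).
  by rewrite /= block_mxEul.
- move=> u; rewrite setTI past_dies_prob -[X in prob Pr X * _]setTI.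
  rewrite (chain_given_extend (lshift s \o u) k (Some (rshift e j)) measurableT mM1 ch).
  by rewrite /= block_mxEur -mulrA !mxE [_ * (c1 * c2)]mulrC.
Qed.

End Pair.

(** * Summation over the patterns *)

Section Final.
Context {R : realType} {e s : nat}.
Context (alpha : 'rV[R]_e) (P : 'M[R]_e) (U : 'M[R]_(e, s)) (Q1 Q2 : 'M[R]_s).
Context (Hpar : parameters alpha P U Q1 Q2).

Definition transform (z0 z1 z2 : R) : R :=
  \sum_(j < s)
       (alpha *m resolvent z0 P *m U) 0 j
       * (resolvent z1 Q1 *m exit_cv Q1) j 0
       * (resolvent z2 Q2 *m exit_cv Q2) j 0.

(** The contribution of the patterns with [k, a, b < N]. *)
Definition partial_transform (z0 z1 z2 : R) N : R :=
  \sum_(j < s)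
       (\sum_i alpha 0 i * gensum z0 P (col j U) i N)
       * gensum z1 Q1 (exit_cv Q1) j N
       * gensum z2 Q2 (exit_cv Q2) j N.

(** Termination is almost sure: since [q = (I - A) 1], the probabilities
    [A^k q] of the termination times add up to one. *)
Lemma resolvent1_exit n (A : 'M[R]_n) : subprob_mx A -> terminating_mx A ->
  resolvent 1 A *m exit_cv A = ones n.
Proof.
move=> sA tA; rewrite /resolvent oner_eq0 invr1.
have uA : 1%:M - A \in unitmx.
  by have := resolvent_unit sA tA (z := 1); rewrite invr1; apply; rewrite ltr01 lexx.
have -> : exit_cv A = (1%:M - A) *m ones n by rewrite mulmxBl mul1mx.
by rewrite mulmxA mulVmx// mul1mx.
Qed.

(** As [U 1 = (I - P) 1], the row vector [alpha (I - P)^-1 U] is a probability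
    on S, the law of the state at [tau12]. *)
Lemma transform111 : transform 1 1 1 = 1.
Proof.
case: Hpar => _ _ [_ a1] sP _ PU sQ1 sQ2 tP tQ1 tQ2.
have U1 : U *m ones s = exit_cv P.
  apply/colP => i; rewrite !mxE.
  have -> : \sum_j P i j * (const_mx 1 : 'cV[R]_e) j 0 = \sum_j P i j.
    by apply: eq_bigr => l _; rewrite mxE mulr1.
  rewrite -[X in X - _](PU i) big_split_ord /= addrAC.
  under [X in X - _]eq_bigr do rewrite row_mxEl.
  rewrite subrr add0r; apply: eq_bigr => l _.
  by rewrite row_mxEr mxE mulr1.
transitivity ((alpha *m resolvent 1 P *m U *m ones s) 0 0).
  rewrite [RHS]mxE; apply: eq_bigr => j _.
  by rewrite !resolvent1_exit// [ones s j 0]mxE !mulr1.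
rewrite -mulmxA U1 -mulmxA resolvent1_exit// mxE -[RHS]a1.
by apply: eq_bigr => i _; rewrite mxE mulr1.
Qed.

Lemma partial_transform_cvg z0 z1 z2 :
  0 <= z0 <= 1 -> 0 <= z1 <= 1 -> 0 <= z2 <= 1 ->
  partial_transform z0 z1 z2 @ \oo --> transform z0 z1 z2.
Proof.
case: Hpar => _ _ _ sP _ _ sQ1 sQ2 tP tQ1 tQ2 h0 h1 h2.
apply: cvg_fin_sum => j; apply: cvgM; [apply: cvgM|]; try exact: gensum_cvg.
rewrite -mulmxA; have -> : (alpha *m (resolvent z0 P *m U)) 0 j =
    \sum_i alpha 0 i * (resolvent z0 P *m col j U) i 0.
  rewrite mxE; apply: eq_bigr => i _; congr (_ * _); rewrite !mxE.
  by apply: eq_bigr => l _; rewrite mxE.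
by apply: cvg_fin_sum => i; apply: cvgMl_tmp; exact: gensum_cvg.
Qed.

Context d {Omega : measurableType d} (Pr : probability Omega R).
Context (M1 M2 : nat -> Omega -> state e s).
Context (HM : chain_pair Pr alpha P U Q1 Q2 M1 M2).

Lemma partial_transformE z0 z1 z2 N :
  \sum_(c : 'I_s * 'I_N * 'I_N * 'I_N)
    z0 ^+ c.1.1.2.+1 * z1 ^+ c.1.2.+1 * z2 ^+ c.2.+1 *
    prob Pr (lives M1 M2 (c.1.1.1, nat_of_ord c.1.1.2, nat_of_ord c.1.2, nat_of_ord c.2)) =
  partial_transform z0 z1 z2 N.
Proof.
pose G (j : 'I_s) (k a b : nat) := z0 ^+ k.+1 * z1 ^+ a.+1 * z2 ^+ b.+1 *
  prob Pr (lives M1 M2 (j, k, a, b)).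
transitivity (\sum_(j < s) \sum_(k < N) \sum_(a < N) \sum_(b < N) G j k a b).
  rewrite (pair_bigA _ (fun (j : 'I_s) (k : 'I_N) => \sum_(a < N) \sum_(b < N) G j k a b)).
  rewrite (pair_bigA _ (fun (p : 'I_s * 'I_N) (a : 'I_N) => \sum_(b < N) G p.1 p.2 a b)).
  rewrite (pair_bigA _ (fun (p : 'I_s * 'I_N * 'I_N) (b : 'I_N) => G p.1.1 p.1.2 p.2 b)).
  by [].
apply: eq_bigr => j _.
have -> : \sum_i alpha 0 i * gensum z0 P (col j U) i N =
    \sum_(k < N) z0 ^+ k.+1 * \sum_i alpha 0 i * mxiter P k (col j U) i 0.
  under eq_bigr do rewrite mulr_sumr; rewrite exchange_big; apply: eq_bigr => k _.
  by rewrite mulr_sumr; apply: eq_bigr => i _; rewrite mulrCA.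
rewrite -mulrA mulr_suml; apply: eq_bigr => k _.
rewrite /gensum mulr_suml mulr_sumr; apply: eq_bigr => a _.
rewrite !mulr_sumr; apply: eq_bigr => b _.
by rewrite /G (lives_prob HM) -mulr_sumr; ring.
Qed.

(** The bounds of [expectation_sandwich] differ by [1 - S_N 1], which tends to
    [0], and both tend to the transform. *)
Lemma expectation_transform z0 z1 z2 (f : Omega -> R) :
  0 <= z0 <= 1 -> 0 <= z1 <= 1 -> 0 <= z2 <= 1 ->
  (forall w, 0 <= f w <= 1) ->
  (forall j k a b w, lives M1 M2 (j, k, a, b) w ->
     f w = z0 ^+ k.+1 * z1 ^+ a.+1 * z2 ^+ b.+1) ->
  ('E_Pr[f] = (transform z0 z1 z2)%:E)%E.
Proof.
move=> h0 h1 h2 f01 fl.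
have z0_ge0 : 0 <= z0 by case/andP: h0.
have z1_ge0 : 0 <= z1 by case/andP: h1.
have z2_ge0 : 0 <= z2 by case/andP: h2.
pose S := partial_transform z0 z1 z2; pose S1 := partial_transform 1 1 1.
have sand N : ((S N)%:E <= 'E_Pr[f] <= (S N + (1 - S1 N))%:E)%E.
  rewrite /S /S1 -!partial_transformE.
  under [X in (1 - X)%R]eq_bigr do rewrite !expr1n !mul1r.
  pose F (c : 'I_s * 'I_N * 'I_N * 'I_N) :=
    lives M1 M2 (c.1.1.1, nat_of_ord c.1.1.2, nat_of_ord c.1.2, nat_of_ord c.2).
  apply: (@expectation_sandwich _ _ _ Pr _ F) => //.
  - by move=> c; exact: (measurable_lives HM).
  - move=> [[[j k] a] b] [[[j' k'] a'] b'] w Fw Fw'.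
    by have [-> /val_inj -> /val_inj -> /val_inj ->] := lives_disjoint HM Fw Fw'.
  - by move=> [[[j k] a] b] w /fl.
  - by move=> c; rewrite !mulr_ge0 ?exprn_ge0.
have cS : S @ \oo --> transform z0 z1 z2 by exact: partial_transform_cvg.
have i01 : 0 <= (1 : R) <= 1 by rewrite ler01 lexx.
have cS1 : (fun N => S N + (1 - S1 N)) @ \oo --> transform z0 z1 z2.
  rewrite -[X in _ --> X]addr0 -(subrr 1).
  apply: cvgD => //; apply: cvgB; first exact: cvg_cst.
  by rewrite -transform111; exact: partial_transform_cvg.
have fin : ('E_Pr[f])%E \is a fin_num.
  have /andP[lo hi] := sand 0%N.
  by rewrite fin_numElt (lt_le_trans _ lo) ?ltNyr// (le_lt_trans hi) ?ltry.
rewrite -(fineK fin); congr EFin; apply/eqP; rewrite eq_le; apply/andP; split.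
  apply: (cvgr_to_ge cS1); near=> N; rewrite -lee_fin fineK//.
  by case/andP: (sand N).
apply: (cvgr_to_le cS); near=> N; rewrite -lee_fin fineK//.
by case/andP: (sand N).
Unshelve. all: by end_near.
Qed.

End Final.

Lemma time_pow_itv (R : realType) (z : R) t : 0 <= z <= 1 -> 0 <= time_pow z t <= 1.
Proof.
move=> /andP[z0 z1]; case: t => [k|] /=; first by rewrite exprn_ge0 ?exprn_ile1.
by case: eqP; rewrite ?lexx ler01.
Qed.

Lemma mulr_itv01 (R : realType) (x y : R) :
  0 <= x <= 1 -> 0 <= y <= 1 -> 0 <= x * y <= 1.
Proof. by move=> /andP[x0 x1] /andP[y0 y1]; rewrite mulr_ge0 ?mulr_ile1. Qed.

Theorem corollary2p2 (R : realType) (e s : nat)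
    (alpha : 'rV[R]_e) (P : 'M[R]_e) (U : 'M[R]_(e, s)) (Q1 Q2 : 'M[R]_s)
    (Hpar : parameters alpha P U Q1 Q2)
    (d : measure_display) (Omega : measurableType d) (Pr : probability Omega R)
    (M1 M2 : nat -> Omega -> state e s)
    (HM : chain_pair Pr alpha P U Q1 Q2 M1 M2)
    (zeta0 zeta1 zeta2 : R)
    (Hzeta0 : 0 <= zeta0 <= 1) (Hzeta1 : 0 <= zeta1 <= 1) (Hzeta2 : 0 <= zeta2 <= 1) :
  ('E_Pr[fun w => (time_pow zeta0 (tau12 M1 w)
                 * time_pow zeta1 (time_sub (tau M1 w) (tau12 M1 w))
                 * time_pow zeta2 (time_sub (tau M2 w) (tau12 M1 w)))%R]
  = (\sum_(j < s)
       (alpha *m resolvent zeta0 P *m U) 0 j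
       * (resolvent zeta1 Q1 *m exit_cv Q1) j 0
       * (resolvent zeta2 Q2 *m exit_cv Q2) j 0)%R%:E)%E
  /\
  ('E_Pr[fun w => (time_pow zeta1 (tau M1 w) * time_pow zeta2 (tau M2 w))%R]
  = (\sum_(j < s)
       (alpha *m resolvent (zeta1 * zeta2) P *m U) 0 j
       * (resolvent zeta1 Q1 *m exit_cv Q1) j 0
       * (resolvent zeta2 Q2 *m exit_cv Q2) j 0)%R%:E)%E.
Proof.
split.
  apply: (expectation_transform Hpar HM Hzeta0 Hzeta1 Hzeta2) => [w|j k a b w].
    by rewrite !mulr_itv01 ?time_pow_itv.
  by move=> /(lives_times HM)[-> _ -> ->]; rewrite /= !addKn.
apply: (expectation_transform Hpar HM (mulr_itv01 Hzeta1 Hzeta2) Hzeta1 Hzeta2).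
  by move=> w; rewrite mulr_itv01 ?time_pow_itv.
move=> j k a b w /(lives_times HM)[_ _ -> ->] /=.
by rewrite !exprD exprMn; ring.
Qed.
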